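(* Let $n,k$ be integers with $0<k\le n$, and let $f_j(\Delta'_{n,k})$ denote the number of $j$-dimensional faces of the half-open hypersimplex $\Delta'_{n,k}$. Then $f_0(\Delta'_{n,k})=\binom{n}{k}$, and for $j=1,2,\ldots,n$, $$ f_j(\Delta'_{n,k})=\binom{n+1}{j+1}\sum_{s=\max\{0,k-j\}}^{k-1}\binom{n-j}{s}\frac{n-s+1}{n+1}. $$
   Context: For integers $0<k\le n$, the (slab) hypersimplex is $\Delta_{n,k}=\{(x_1,\ldots,x_n)\in[0,1]^n : k-1\le x_1+\cdots+x_n\le k\}$, a convex polytope in $\mathbb{R}^n$, and the half-open hypersimplex is $\Delta'_{n,k}=\{(x_1,\ldots,x_n)\in[0,1]^n : k-1< x_1+\cdots+x_n\le k\}$, i.e. $\Delta_{n,k}$ with its intersection with the hyperplane $x_1+\cdots+x_n=k-1$ removed. A $j$-face of $\Delta'_{n,k}$ is a set $F\cap\Delta'_{n,k}$ where $F$ is a $j$-dimensional face of the polytope $\Delta_{n,k}$ with $F\cap\Delta'_{n,k}\neq\emptyset$; $f_j(\Delta'_{n,k})$ is the number of such faces. Binomial coefficients $\binom{a}{b}$ are $0$ when $b>a$. *)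

(* Defs.v *)
From HB Require Import structures.
From mathcomp Require Import all_boot all_order all_algebra.
From mathcomp Require Import boolp classical_sets cardinality reals.
Set Implicit Arguments. Unset Strict Implicit. Unset Printing Implicit Defensive.
Import Order.TTheory GRing.Theory Num.Theory.
Local Open Scope ring_scope.
Local Open Scope classical_set_scope.

Section HalfOpenHypersimplex.
Variable R : realType.

Definition dotv n (c x : 'rV[R]_n) : R := \sum_(i < n) c ord0 i * x ord0 i.

Definition hypersimplex (n k : nat) : set 'rV[R]_n :=
  [set x | (forall i : 'I_n, 0 <= x ord0 i <= 1) /\
           (k%:R - 1 <= \sum_(i < n) x ord0 i <= k%:R)].

Definition half_open_hypersimplex (n k : nat) : set 'rV[R]_n :=
  [set x | (forall i : 'I_n, 0 <= x ord0 i <= 1) /\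
           (k%:R - 1 < \sum_(i < n) x ord0 i <= k%:R)].

(* F is a face of the convex set P: the intersection of P with a supporting
   hyperplane {c.x = d}, where c.x <= d on P (c = 0, d = 0 gives P itself). *)
Definition face n (P F : set 'rV[R]_n) : Prop :=
  exists (c : 'rV[R]_n) (d : R),
    (forall x, P x -> dotv c x <= d) /\ F = [set x | P x /\ dotv c x = d].

Definition affine_indep n m (p : 'I_m.+1 -> 'rV[R]_n) : Prop :=
  \rank (\matrix_(i < m) (p (lift ord0 i) - p ord0)) = m.

Definition has_dim n (F : set 'rV[R]_n) (j : nat) : Prop :=
  (exists p : 'I_j.+1 -> 'rV[R]_n, (forall i, F (p i)) /\ affine_indep p) /\
  (forall p : 'I_j.+2 -> 'rV[R]_n, (forall i, F (p i)) -> ~ affine_indep p).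

Definition half_open_faces (n k j : nat) : set (set 'rV[R]_n) :=
  [set S | exists F : set 'rV[R]_n,
      [/\ @face n (@hypersimplex n k) F, @has_dim n F j,
          S = F `&` @half_open_hypersimplex n k & S !=set0]].

End HalfOpenHypersimplex.

Arguments hypersimplex R n k : clear implicits.
Arguments half_open_hypersimplex R n k : clear implicits.
Arguments half_open_faces R n k j : clear implicits.

(* Main.v *)
Require Import Defs.
From HB Require Import structures.
From mathcomp Require Import all_boot all_order all_algebra.
From mathcomp Require Import boolp classical_sets cardinality reals.
From mathcomp Require Import zify ring lra.
Import Order.TTheory GRing.Theory Num.Theory.
Local Open Scope ring_scope.
Local Open Scope classical_set_scope.

(* A point x of the half-open hypersimplex has a type: the set M of coordinates
   strictly between 0 and 1, the set B of coordinates equal to 1, and whether x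
   lies on the hyperplane of coordinate sum k.  A face meeting the half-open
   hypersimplex consists of all points satisfying the tight constraints of any
   one of its generic points, and its dimension is |M| or |M| - 1 accordingly.
   A type with M, B disjoint is realised off the hyperplane iff
   |B| < k <= |B| + |M|, and on it iff |B| < k < |B| + |M| or M is empty and
   |B| = k.  Hence for j > 0 both kinds of j-faces have k - j <= |B| < k, and
   choosing M, then B, counts C(n,j) C(n-j,s) + C(n,j+1) C(n-j-1,s) faces with
   |B| = s. *)

(** * Step sizes and affine dimension *)

(** One step respecting finitely many slacks [a] under variations [b]: every ratio |b i| / a i is at
    most their sum [s], so 1 / (1 + s) works. *)
Lemma uniform_step {R : realFieldType} {I : finType} (a b : I -> R) :
  (forall i, 0 < a i) -> exists2 e, 0 < e & forall i, e * `|b i| <= a i.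
Proof.
move=> a0; set s := \sum_i `|b i| / a i.
have q0 i : 0 <= `|b i| / a i by rewrite divr_ge0 // ltW.
have s0 : 0 <= s by apply: sumr_ge0.
exists (1 + s)^-1 => [|i]; first by rewrite invr_gt0; lra.
rewrite mulrC ler_pdivrMr; last lra.
rewrite -ler_pdivrMl // mulrC.
have : `|b i| / a i <= s by rewrite /s (bigD1 i) //= lerDl sumr_ge0.
lra.
Qed.

(** If b < a, the first b + 2 points of an affinely independent family of a + 1 points are still
    independent, against the maximality of b. *)
Lemma has_dim_inj {R : realType} {n} (F : set 'rV[R]_n) i j :
  has_dim F i -> has_dim F j -> i = j.
Proof.
have le a b : has_dim F a -> has_dim F b -> (a <= b)%N.
  move=> [[p [Fp ip]] _] [_ nb]; rewrite leqNgt; apply/negP => ltba.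
  pose h := widen_ord (ltba : (b.+2 <= a.+1)%N).
  apply: (nb (p \o h)) => [l|]; first exact: Fp.
  have /row_freeP[B pB] : row_free (\matrix_(l < a) (p (lift ord0 l) - p ord0)).
    by rewrite /row_free; apply/eqP.
  pose g := widen_ord ltba.
  (* Keeping the first rows of a matrix, the corresponding columns of its right inverse [B] form a
     right inverse. *)
  rewrite /affine_indep; apply/eqP/row_freeP; exists (colsub g B).
  have -> : \matrix_(l < b.+1) ((p \o h) (lift ord0 l) - (p \o h) ord0)
      = rowsub g (\matrix_(l < a) (p (lift ord0 l) - p ord0)).
    apply/matrixP => r c; rewrite !mxE /=; congr (p _ _ _ - p _ _ _).
      exact: val_inj.
    exact: val_inj.
  by rewrite mul_rowsub_mx mulmx_colsub pB; apply/matrixP => r c; rewrite !mxE.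
by move=> hi hj; apply/eqP; rewrite eqn_leq !le.
Qed.

(** Since [w] vanishes at the coordinates [f l], the vectors e_(f l) - w restrict there to the
    identity matrix and are independent. Steps along them from [x] bound the dimension below;
    spanning all differences bounds it above. *)
Lemma has_dim_basis {R : realType} {n j} (F : set 'rV[R]_n) (f : 'I_j -> 'I_n)
    (w x : 'rV[R]_n) (e : R) :
  injective f -> (forall l, w ord0 (f l) = 0) -> e != 0 -> F x ->
  (forall l, F (x + e *: (delta_mx ord0 (f l) - w))) ->
  (forall y z, F y -> F z ->
    y - z = \sum_l (y - z) ord0 (f l) *: (delta_mx ord0 (f l) - w)) ->
  has_dim F j.
Proof.
move=> f_inj wf e0 Fx Fe span.
pose A : 'M[R]_(j, n) := \matrix_l (delta_mx ord0 (f l) - w).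
have rA : row_free A.
  apply/row_freeP; exists (\matrix_(i, l) (i == f l)%:R).
  apply/matrixP => l l'; rewrite !mxE (bigD1 (f l')) //= big1 => [|i ne]; last first.
    by rewrite !mxE (negbTE ne) mulr0.
  by rewrite !mxE !eqxx /= wf subr0 addr0 mulr1 (inj_eq f_inj) eq_sym.
split.
  exists (fun i => if unlift ord0 i is Some l
                   then x + e *: (delta_mx ord0 (f l) - w) else x).
  split=> [i|]; first by case: unliftP => [l _|_].
  rewrite /affine_indep (_ : \matrix_(i < j) _ = e *: A) ?mxrank_scale_nz //.
    exact/eqP.
  apply/row_matrixP => l; rewrite rowK linearZ /= rowK liftK unlift_none.
  by rewrite addrC addKr.
move=> p Fp; rewrite /affine_indep => rk.
have : (\matrix_(i < j.+1) (p (lift ord0 i) - p ord0)%R <= A)%MS.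
  apply/row_subP => i; rewrite rowK (span _ _ (Fp _) (Fp _)).
  apply: summx_sub => l _; apply: scalemx_sub.
  by rewrite -(rowK (fun l => delta_mx ord0 (f l) - w)) row_sub.
move/mxrankS; rewrite rk => /leq_trans/(_ (rank_leq_row _)).
by rewrite ltnn.
Qed.

(** * Small moves inside the hypersimplex *)

Lemma sum_coordD {R : realType} {n} (x v : 'rV[R]_n) (e : R) :
  \sum_i (x + e *: v) ord0 i = \sum_i x ord0 i + e * \sum_i v ord0 i.
Proof.
rewrite mulr_sumr -big_split /=.
by apply: eq_bigr => i _; rewrite !mxE.
Qed.

Lemma dotvD {R : realType} {n} (c x v : 'rV[R]_n) (e : R) :
  dotv c (x + e *: v) = dotv c x + e * dotv c v.
Proof.
rewrite /dotv mulr_sumr -big_split /=.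
by apply: eq_bigr => i _; rewrite !mxE mulrDr mulrCA.
Qed.

Lemma half_open_sub {R : realType} {n k} (x : 'rV[R]_n) :
  half_open_hypersimplex R n k x -> hypersimplex R n k x.
Proof.
by move=> [x01 /andP[/ltW ge le]]; split=> //; rewrite ge le.
Qed.

(** Constraints tight at [x] are unaffected by the directions, and the others have positive slack,
    so a common small step stays inside. The lower bound k - 1 on the sum is never tight at a
    half-open point. *)
Lemma hypersimplex_move {R : realType} {n k} {J : finType} (x : 'rV[R]_n)
    (v : J -> 'rV[R]_n) :
  half_open_hypersimplex R n k x ->
  (forall l i, ~~ (0 < x ord0 i < 1) -> v l ord0 i = 0) ->
  (forall l, \sum_i x ord0 i = k%:R -> \sum_i v l ord0 i = 0) ->
  exists2 e, 0 < e & forall l, hypersimplex R n k (x + e *: v l).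
Proof.
set s := \sum_i _ => -[x01 /andP[sgt sle]] v0 vs.
(* [a] is the slack and [b] the variation along [v l]; [Some i] stands for the bounds on coordinate
   i and [None] for those on the sum. A tight constraint gets the dummy slack 1, its variation being
   0. *)
pose a (t : J * option 'I_n) := if t.2 is Some i
  then if 0 < x ord0 i < 1 then Num.min (x ord0 i) (1 - x ord0 i) else 1
  else if s == k%:R then 1 else Num.min (s - (k%:R - 1)) (k%:R - s).
pose b (t : J * option 'I_n) := if t.2 is Some i then v t.1 ord0 i
  else \sum_i v t.1 ord0 i.
have [|e e0 be] := @uniform_step _ _ a b.
  move=> [l [i|]]; rewrite /a /=; case: ifP => //.
    by move=> /andP[? ?]; rewrite lt_min; apply/andP; split; lra.
  by move=> ne; rewrite lt_min !subr_gt0 sgt lt_neqAle ne.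
exists e => // l; split=> [i|].
  rewrite !mxE; have := be (l, Some i); rewrite /a /b /=.
  case: ifP => [_|/negbT/v0->]; last by rewrite mulr0 addr0.
  by rewrite -[e in e * `|_|](gtr0_norm e0) -normrM le_min !ler_norml => /andP[/andP[? ?] /andP[? ?]]; apply/andP; split; lra.
rewrite sum_coordD -/s; have := be (l, None); rewrite /a /b /=.
case: eqP => [sk _|_]; first by rewrite vs // mulr0 addr0; lra.
by rewrite -[e in e * `|_|](gtr0_norm e0) -normrM le_min !ler_norml => /andP[/andP[? ?] /andP[? ?]]; apply/andP; split; lra.
Qed.

(** * Types of points and their cells *)

(* (M, B, b): free coordinates, coordinates equal to 1, and whether the sum is k. *)
Definition face_type n : Type := ({set 'I_n} * {set 'I_n} * bool)%type.

Definition type_of {R : realType} {n} (k : nat) (x : 'rV[R]_n) : face_type n :=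
  ([set i | 0 < x ord0 i < 1]%SET, [set i | x ord0 i == 1]%SET,
   \sum_i x ord0 i == k%:R).

(** Only the equalities of the type are imposed: free coordinates may reach 0 or 1, and a false flag
    still allows the sum k, so that the cell is closed. *)
Definition cell (R : realType) {n} (k : nat) (t : face_type n) : set 'rV[R]_n :=
  [set x | [/\ hypersimplex R n k x,
               forall i, i \notin t.1.1 -> x ord0 i = (i \in t.1.2)%:R &
               t.2 -> \sum_i x ord0 i = k%:R]].

Lemma cell_type_of {R : realType} {n k} (x : 'rV[R]_n) :
  hypersimplex R n k x -> cell R k (type_of k x) x.
Proof.
move=> Px; split=> // [i|/eqP //]; rewrite !inE.
by have := Px.1 i; case: eqP => /=; lra.
Qed.

(** The supporting functional adds the coordinates of B outside M, subtracts those outside both, and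
    adds the total sum if b holds. Each term has its own upper bound, so the maximum is reached
    exactly when every term is maximal. *)
Lemma face_cell {R : realType} {n k} (t : face_type n) :
  face (hypersimplex R n k) (cell R k t).
Proof.
case: t => -[M B] b /=.
pose c : 'rV[R]_n := \row_i ((i \notin M)%:R * (-1) ^+ (i \notin B) + b%:R).
pose u (x : 'rV[R]_n) i := (i \notin M)%:R * (-1) ^+ (i \notin B) * x ord0 i.
pose w i : R := ((i \notin M) && (i \in B))%:R.
have cE x : dotv c x = \sum_i u x i + b%:R * \sum_i x ord0 i.
  rewrite /dotv mulr_sumr -big_split /=.
  by apply: eq_bigr => i _; rewrite !mxE mulrDl.
have uw x i : hypersimplex R n k x -> u x i <= w i ?= iff
    ((i \notin M) ==> (x ord0 i == (i \in B)%:R)).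
  move=> [x01 _]; have := x01 i; rewrite /u /w.
  case: (i \in M) => /= [_|]; first by rewrite !mul0r; split; rewrite ?eqxx.
  by case: (i \in B) => /= /andP[? ?]; split; rewrite ?expr0 ?expr1 ?mul1r //;
    rewrite ?mulN1r ?oppr_eq0 ?oppr_le0.
have uws x : hypersimplex R n k x -> \sum_i u x i <= \sum_i w i ?= iff
    [forall (i | true), (i \notin M) ==> (x ord0 i == (i \in B)%:R)].
  by move=> Px; apply: leif_sum => i _; exact: uw.
have bs x : hypersimplex R n k x ->
    b%:R * \sum_i x ord0 i <= b%:R * k%:R ?= iff (b ==> (\sum_i x ord0 i == k%:R)).
  move=> [_ sx]; case: b c cE => _ _ /=; rewrite ?mul1r ?mul0r; split; rewrite ?eqxx //.
  by case/andP: sx.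
have cws x (Px : hypersimplex R n k x) := leifD (uws x Px) (bs x Px).
exists c, (\sum_i w i + b%:R * k%:R); split=> [x Px|].
  by rewrite cE; case: (cws x Px).
apply/seteqP; split=> x /=.
  move=> [Px xM xb]; split=> //; rewrite cE; apply/eqP.
  rewrite (cws x Px).2; apply/andP; split; last by apply/implyP => /xb/eqP.
  by apply/forallP => i /=; apply/implyP => /xM/eqP.
move=> [Px /eqP]; rewrite cE (cws x Px).2 => /andP[/forallP h /implyP hb].
by split=> // [i iM|/hb/eqP//]; have := h i; rewrite /= iM /= => /eqP.
Qed.

(** Each point satisfies the tight constraints of the other, so both have the same ones. *)
Lemma type_of_anti {R : realType} {n k} (x y : 'rV[R]_n) :
  cell R k (type_of k x) y -> cell R k (type_of k y) x ->
  type_of k x = type_of k y.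
Proof.
move=> [_ yM yb] [_ xM xb].
have e i : ((0 < x ord0 i < 1) = (0 < y ord0 i < 1)) /\
           ((x ord0 i == 1) = (y ord0 i == 1)).
  have := xM i; have := yM i; rewrite !inE.
  case: (boolP (0 < x ord0 i < 1)) => hx; case: (boolP (0 < y ord0 i < 1)) => hy.
  - by move: hx hy => /andP[_ hx] /andP[_ hy]; rewrite !lt_eqF.
  - by move=> _ /(_ isT) xi; move: hx; rewrite xi; case: (_ == _); rewrite ltxx ?andbF.
  - by move=> /(_ isT) yi _; move: hy; rewrite yi; case: (_ == _); rewrite ltxx ?andbF.
  - move=> /(_ isT) yi _; split=> //; rewrite yi.
    by case: (x ord0 i == 1); rewrite ?eqxx // eq_sym oner_eq0.
rewrite /type_of; congr (_, _, _).
- by apply/setP => i; rewrite !inE (e i).1.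
- by apply/setP => i; rewrite !inE (e i).2.
- by apply/eqP/eqP => [/eqP/yb|/eqP/xb].
Qed.

(** * Faces meeting the half-open hypersimplex are cells *)

(* A point of the face with as few tight constraints as possible is tight only
   where the whole face is: otherwise its midpoint with another point of the
   face would be tight less often. *)
Lemma face_generic {R : realType} {n k} (F : set 'rV[R]_n) :
  face (hypersimplex R n k) F -> F `&` half_open_hypersimplex R n k !=set0 ->
  exists x, [/\ F x, half_open_hypersimplex R n k x & F `<=` cell R k (type_of k x)].
Proof.
move=> [c [d [cd Fdef]]] [x1 [Fx1 hx1]].
pose m (x : 'rV[R]_n) := (#|~: (type_of k x).1.1| + (type_of k x).2)%N.
pose S x := F x /\ half_open_hypersimplex R n k x.
have exN : exists N, `[< exists2 x, S x & m x = N >].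
  by exists (m x1); apply/asboolP; exists x1.
case: (ex_minnP exN) => N /asboolP[x [Fx hx] mx] minN.
exists x; split=> // y Fy.
have [Px cx] : hypersimplex R n k x /\ dotv c x = d by move: Fx; rewrite Fdef.
have [Py cy] : hypersimplex R n k y /\ dotv c y = d by move: Fy; rewrite Fdef.
pose z := x + 2^-1 *: (y + (-1) *: x).
have zi i : z ord0 i = (x ord0 i + y ord0 i) / 2 by rewrite !mxE; field.
have zs : \sum_i z ord0 i = (\sum_i x ord0 i + \sum_i y ord0 i) / 2.
  by rewrite /z !sum_coordD; field.
have hz : half_open_hypersimplex R n k z.
  split=> [i|].
    rewrite zi; have /andP[? ?] := Px.1 i; have /andP[? ?] := Py.1 i.
    by apply/andP; split; lra.
  rewrite zs; have /andP[? ?] := hx.2; have /andP[? ?] := Py.2.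
  by apply/andP; split; lra.
have Fz : F z.
  by rewrite Fdef; split; [exact: half_open_sub | rewrite /z !dotvD cx cy; field].
have : (N <= m z)%N by apply: minN; apply/asboolP; exists z.
(* An average of two numbers of [0,1] is an endpoint only if both are that endpoint. *)
have tight i : ~~ (0 < z ord0 i < 1) ->
    ~~ (0 < x ord0 i < 1) /\ y ord0 i = (x ord0 i == 1)%:R.
  rewrite zi; have /andP[? ?] := Px.1 i; have /andP[? ?] := Py.1 i.
  rewrite negb_and -!leNgt => /orP[] h.
    have [-> ->] : x ord0 i = 0 /\ y ord0 i = 0 by split; lra.
    by rewrite ltxx eq_sym oner_eq0.
  have [-> ->] : x ord0 i = 1 /\ y ord0 i = 1 by split; lra.
  by rewrite ltxx andbF eqxx.
have sub : ~: (type_of k z).1.1 \subset ~: (type_of k x).1.1.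
  by apply/fintype.subsetP => i; rewrite !inE => /tight[].
have ble : (type_of k z).2 -> (type_of k x).2 /\ \sum_i y ord0 i = k%:R.
  rewrite /= zs => /eqP h; have /andP[? ?] := Px.2; have /andP[? ?] := Py.2.
  by split; [apply/eqP|]; lra.
have ble' : ((type_of k z).2 <= (type_of k x).2)%N.
  by move: ble; case: (type_of k z).2 => // /(_ isT)[->].
have cle := subset_leq_card sub.
rewrite -mx /m => le.
(* Both contributions to [m] can only drop from [x] to [z], so minimality makes them equal. *)
have /eqP eqM : ~: (type_of k z).1.1 == ~: (type_of k x).1.1 by rewrite eqEcard sub; lia.
have eqb : (type_of k z).2 = (type_of k x).2.
  by move: ble' le cle; case: (type_of k z).2; case: (type_of k x).2 => //; lia.
split=> // [i|].
  by rewrite -finset.in_setC -eqM !inE => /tight[].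
by move=> hb; apply: (ble _).2; rewrite eqb.
Qed.

Lemma face_eq_cell {R : realType} {n k} (F : set 'rV[R]_n) :
  face (hypersimplex R n k) F -> F `&` half_open_hypersimplex R n k !=set0 ->
  exists2 x, half_open_hypersimplex R n k x & F = cell R k (type_of k x).
Proof.
move=> fF /(face_generic F fF)[x [Fx hx sub]]; exists x => //.
apply/seteqP; split=> // y [Py yM yb].
case: fF Fx => c [d [cd ->]] [_ cx]; split=> //.
have [Px xM xb] := cell_type_of _ (half_open_sub _ hx).
(* From the generic point [x], a small move away from [y] stays in the polytope. As [c] is maximal
   at [x], it cannot increase along x - y, whence c.y >= d. *)
have [l i h|l s|e e0 /(_ tt)/cd] :=
  hypersimplex_move x (fun _ : unit => x + (-1) *: y) hx.
- by rewrite !mxE yM ?xM ?inE //; ring.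
- by rewrite sum_coordD yb ?s /=; [ring | exact/eqP].
rewrite !dotvD cx => h; apply/eqP; rewrite eq_le cd //=.
have : e * (d + -1 * dotv c y) <= 0 by lra.
by rewrite pmulr_rle0 //; lra.
Qed.

(** * Dimension of a cell *)

Lemma has_dim_cell {R : realType} {n k} (x : 'rV[R]_n) :
  half_open_hypersimplex R n k x ->
  has_dim (cell R k (type_of k x)) (#|(type_of k x).1.1| - (type_of k x).2).
Proof.
move=> hx; set M := (type_of k x).1.1; set b := (type_of k x).2.
have Cx := cell_type_of _ (half_open_sub _ hx).
(* [D] is the direction space of the cell: vectors supported on [M], of zero sum if [b] holds. *)
pose D (v : 'rV[R]_n) := (forall i, i \notin M -> v ord0 i = 0) /\
  (b -> \sum_i v ord0 i = 0).
have key j (f : 'I_j -> 'I_n) (w : 'rV[R]_n) : injective f ->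
    (forall l, w ord0 (f l) = 0) -> (forall l, D (delta_mx ord0 (f l) - w)) ->
    (forall v, D v -> v = \sum_l v ord0 (f l) *: (delta_mx ord0 (f l) - w)) ->
    has_dim (cell R k (type_of k x)) j.
  move=> f_inj wf Dw span.
  have [l i h|l s|e e0 eP] := hypersimplex_move x
      (fun l => delta_mx ord0 (f l) - w) hx.
  - by apply: (Dw l).1; rewrite inE.
  - by apply: (Dw l).2; apply/eqP.
  apply: (@has_dim_basis _ _ _ _ f w x e) => // [|l|y z [_ yM yb] [_ zM zb]].
  - by rewrite gt_eqF.
  - have [_ xM xb] := Cx; split=> // [i iM|hb].
      by rewrite mxE [X in _ + X]mxE (Dw l).1 // mulr0 addr0 xM.
    by rewrite sum_coordD (Dw l).2 // mulr0 addr0 xb.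
  - apply: span; split=> [i iM|hb].
      by rewrite !mxE yM // zM // subrr.
    by rewrite -scaleN1r sum_coordD yb // zb //; ring.
have deltaE i l : (delta_mx ord0 l : 'rV[R]_n) ord0 i = (i == l)%:R by rewrite mxE.
have sum_delta l : \sum_i (delta_mx ord0 l : 'rV[R]_n) ord0 i = 1.
  by rewrite (bigD1 l) //= big1 => [|i /negbTE il]; rewrite deltaE ?eqxx ?addr0 ?il.
have spanE (A : {set 'I_n}) (v w : 'rV[R]_n) i :
    (\sum_(l < #|A|) v ord0 (enum_val l) *: (delta_mx ord0 (enum_val l) - w)) ord0 i
    = (if i \in A then v ord0 i else 0) - (\sum_(l in A) v ord0 l) * w ord0 i.
  rewrite -(big_enum_val (fun l => v ord0 l *: (delta_mx ord0 l - w))) /=.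
  rewrite summxE mulr_suml.
  under eq_bigr do rewrite !mxE eqxx mulrBr /=.
  rewrite sumrB; congr (_ - _); case: ifPn => iA; last first.
    by rewrite big1 // => l lA; case: eqP => [il|_]; [rewrite il lA in iA|rewrite mulr0].
  by rewrite (bigD1 i) //= eqxx mulr1 big1 ?addr0 // => l /andP[_ /negbTE li];
    rewrite eq_sym li mulr0.
(* The unit vectors of [M] form a basis when the sum is unconstrained, and also when [M] is empty,
   where the sum condition is automatic. *)
have plain : (b -> M = finset.set0) -> has_dim (cell R k (type_of k x)) #|M|.
  move=> bM; apply: (key _ enum_val 0) => [|l|l|v [vM _]].
  - exact: enum_val_inj.
  - by rewrite mxE.
  - rewrite subr0; split=> [i|/bM M0].
      by rewrite deltaE; case: eqP => // ->; rewrite enum_valP.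
    by exfalso; case: (l) => o; rewrite M0 cards0.
  - apply/rowP => i; rewrite spanE mxE mulr0 subr0.
    by case: ifPn => // /vM.
case: (boolP b) => hb; last by rewrite subn0; apply: plain; rewrite (negbTE hb).
(* For empty [M] the truncated difference 0 - 1 is the right dimension 0. Otherwise the vectors e_l
   - e_i0, with l in [M] other than [i0], form a basis of the zero-sum space. *)
have [M0|[i0 i0M]] := set_0Vmem M; first by have := plain (fun=> M0); rewrite M0 cards0.
have -> : (#|M| - true)%N = #|M :\ i0| by rewrite (cardsD1 i0 M) i0M; lia.
apply: (key _ enum_val (delta_mx ord0 i0)) => [|l|l|v [vM vs]].
- exact: enum_val_inj.
- by have := enum_valP l; rewrite deltaE !inE; case: eqP.
- split=> [i iM|_].
    have := enum_valP l; rewrite !mxE eqxx /= finset.in_setD1 => /andP[_ lM].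
    by case: eqP => [il|_]; [rewrite il lM in iM | case: eqP => [i0E|_]; [rewrite i0E i0M in iM|rewrite subrr]].
  by rewrite -scaleN1r sum_coordD !sum_delta; ring.
- apply/rowP => i; rewrite spanE finset.in_setD1 deltaE.
  have s0 : \sum_(l in M :\ i0) v ord0 l = - v ord0 i0.
    have := vs hb; rewrite (bigID (mem M)) /= [X in _ + X = _]big1 => [|l /vM //].
    by rewrite addr0 (big_setD1 i0) //= addrC => /eqP; rewrite addr_eq0 => /eqP.
  rewrite s0; case: (eqVneq i i0) => [->|_] /=; first by ring.
  by rewrite mulr0 subr0; case: ifPn => // /vM.
Qed.

(** * The types that occur *)

Definition admissible {n} (k : nat) (t : face_type n) : bool :=
  let: (M, B, b) := t in
  (B \subset ~: M) &&
  (if b then ((#|M| == 0) && (#|B| == k)) || (#|B| < k < #|B| + #|M|)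
   else #|B| < k <= #|B| + #|M|)%N.

Lemma sum_split {R : realType} {n} (M B : {set 'I_n}) (x : 'rV[R]_n) :
  B \subset ~: M -> (forall i, i \notin M -> x ord0 i = (i \in B)%:R) ->
  \sum_i x ord0 i = #|B|%:R + \sum_(i in M) x ord0 i.
Proof.
move=> BM xM; rewrite (bigID (mem M)) /= addrC; congr (_ + _).
rewrite (eq_bigr _ xM) -natr_sum -big_mkcondr sum1dep_card.
congr (_%:R); apply: eq_card => i; rewrite inE andbC.
case: (boolP (i \in B)) => //= /(fintype.subsetP BM).
by rewrite inE.
Qed.

(** The coordinate sum is |B| plus |M| numbers strictly between 0 and 1, so it lies strictly between
    |B| and |B| + |M| unless M is empty. *)
Lemma admissible_type_of {R : realType} {n k} (x : 'rV[R]_n) :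
  half_open_hypersimplex R n k x -> admissible k (type_of k x).
Proof.
move=> hx; have [_ xM _] := cell_type_of _ (half_open_sub _ hx).
have [x01 /andP[sgt sle]] := hx; rewrite /admissible.
move: (erefl (type_of k x)) xM; rewrite {1}/type_of; case: (type_of k x) => -[M B] b.
move=> [ME BE bE] /= xM.
have BM : B \subset ~: M.
  apply/fintype.subsetP => i; rewrite -BE -ME !inE => /eqP->.
  by rewrite ltxx andbF.
have sE := sum_split _ _ _ BM xM.
have s0 : 0 <= \sum_(i in M) x ord0 i.
  by apply: sumr_ge0 => i _; case/andP: (x01 i).
have s1 : \sum_(i in M) x ord0 i <= #|M|%:R.
  by rewrite -sumr_const; apply: ler_sum => i _; case/andP: (x01 i).
have sM : M != finset.set0 -> 0 < \sum_(i in M) x ord0 i < #|M|%:R.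
  case/finset.set0Pn => i iM.
  have xM01 l : l \in M -> 0 < x ord0 l < 1 by rewrite -ME inE.
  have hM : has (mem M) (index_enum 'I_n).
    by apply/hasP; exists i; rewrite ?mem_index_enum.
  have := ltr_sum (F := fun=> 0) (G := x ord0) hM (fun l lM => proj1 (andP (xM01 l lM))).
  have := ltr_sum (F := x ord0) (G := fun=> 1) hM (fun l lM => proj2 (andP (xM01 l lM))).
  by rewrite sumr_const big1_eq => -> ->.
rewrite BM -bE /=; case: eqVneq => [sk|sk].
  have [M0|/sM/andP[? ?]] := eqVneq M finset.set0.
    move: sE; rewrite sk M0 big_set0 addr0 cards0 => /eqP.
    by rewrite eqr_nat eq_sym => ->.
  by apply/orP; right; rewrite -!(ltr_nat R) natrD; apply/andP; split; lra.
have slt : \sum_i x ord0 i < k%:R by rewrite lt_neqAle sk.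
have -> : (#|B| < k)%N by rewrite -(ltr_nat R); lra.
(* Here k - 1 < |B| + |M|, that is k < |B| + |M| + 1. *)
by rewrite -ltnS -(ltr_nat R) -addn1 !natrD; lra.
Qed.

(** The witness gives all free coordinates one common value [u], chosen so that the sum is k on the
    hyperplane and k - 1/2 off it. *)
Lemma admissible_ex {R : realType} {n k} (t : face_type n) :
  admissible k t ->
  exists2 x, half_open_hypersimplex R n k x & type_of k x = t.
Proof.
case: t => -[M B] b /andP[BM adm].
pose del : R := if b then 0 else 2^-1.
(* The value 1/2 for empty [M] is a dummy that keeps 0 < u < 1. *)
pose u : R := if M == finset.set0 then 2^-1 else (k%:R - del - #|B|%:R) / #|M|%:R.
pose x : 'rV[R]_n := \row_i (if i \in M then u else (i \in B)%:R).
have xE i : x ord0 i = if i \in M then u else (i \in B)%:R by rewrite mxE.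
have xM i : i \notin M -> x ord0 i = (i \in B)%:R by rewrite xE => /negbTE->.
have u01 : 0 < u < 1.
  rewrite /u; case: eqVneq => [_|M0]; first by apply/andP; split; lra.
  have m0 : (0 : R) < #|M|%:R by rewrite ltr0n card_gt0.
  have [lo hi] : #|B|%:R < k%:R - del /\ k%:R - del < #|B|%:R + #|M|%:R.
    move: adm; rewrite /del; case: (b).
      rewrite cards_eq0 (negbTE M0) /= -!(ltr_nat R) natrD => /andP[? ?].
      by split; lra.
    rewrite -(ler_nat R) -(ler_nat R k) natrD -addn1 natrD => /andP[? ?].
    by split; lra.
  by rewrite divr_gt0 ?ltr_pdivrMr ?mul1r //; lra.
have sx : \sum_i x ord0 i = k%:R - del.
  rewrite (sum_split _ _ _ BM xM) (eq_bigr (fun=> u)); last by move=> i; rewrite xE => ->.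
  rewrite sumr_const /u; case: eqVneq => [M0|M0].
    move: adm; rewrite M0 cards0 /del; case: (b); last by lia.
    by case/orP => [/eqP->|]; [rewrite mulr0n subr0 addr0|lia].
  have m0 : #|M|%:R != 0 :> R by rewrite pnatr_eq0 cards_eq0.
  by rewrite -mulr_natr; field.
have /andP[u0 u1] := u01.
have bE : (k%:R - del == k%:R) = b.
  by rewrite /del; case: (b);
    [rewrite subr0 eqxx|apply/eqP; lra].
exists x.
  split=> [i|]; last by rewrite sx /del; apply/andP; split; case: ifP => _; lra.
  rewrite xE; case: ifP => _; first by rewrite !ltW.
  by case: (i \in B); rewrite ?lexx ler01.
rewrite /type_of sx bE; congr (_, _, _); apply/setP => i; rewrite inE xE.
  by case: ifP => // _; case: (i \in B); rewrite ltxx ?andbF.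
case: ifP => [iM|_]; last by case: (i \in B); rewrite ?eqxx // eq_sym oner_eq0.
rewrite lt_eqF //; apply/esym/negbTE; apply/negP => /(fintype.subsetP BM).
by rewrite inE iM.
Qed.

(** * Bijection between faces and admissible types *)

Definition face_types n k j : {set face_type n} :=
  [set t | admissible k t && (#|t.1.1| - t.2 == j)%N]%SET.

Definition half_open_cell (R : realType) {n} (k : nat) (t : face_type n) :=
  cell R k t `&` half_open_hypersimplex R n k.

Lemma half_open_facesE (R : realType) n k j :
  half_open_faces R n k j = half_open_cell R k @` [set t | t \in face_types n k j].
Proof.
apply/seteqP; split=> S /=.
  move=> [F [fF dF -> S0]]; have [x hx FE] := face_eq_cell _ fF S0.
  exists (type_of k x); last by rewrite /half_open_cell -FE.
  rewrite inE admissible_type_of //=; apply/eqP.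
  by apply: (has_dim_inj F) dF; rewrite FE; exact: has_dim_cell.
move=> [t]; rewrite inE => /andP[/(admissible_ex (R:=R))[x hx <-] /eqP <-] <-.
exists (cell R k (type_of k x)); split=> //.
- exact: face_cell.
- exact: has_dim_cell.
- by exists x; split=> //; apply: cell_type_of; exact: half_open_sub.
Qed.

(** Each type is realised by a point of its own half-open cell; if the cells agree, each of the two
    points lies in the cell of the other. *)
Lemma half_open_cell_inj (R : realType) {n k} (s t : face_type n) :
  admissible k s -> admissible k t ->
  half_open_cell R k s = half_open_cell R k t -> s = t.
Proof.
move=> /(admissible_ex (R:=R))[x hx <-] /(admissible_ex (R:=R))[y hy <-] e.
have Cx := cell_type_of _ (half_open_sub _ hx).
have Cy := cell_type_of _ (half_open_sub _ hy).
apply: type_of_anti.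
  by have [] : half_open_cell R k (type_of k x) y by rewrite e.
by have [] : half_open_cell R k (type_of k y) x by rewrite -e.
Qed.

Lemma card_image_set {T : finType} {U : Type} (A : {set T}) (f : T -> U) :
  {in A &, injective f} -> (f @` [set t | t \in A] #= `I_#|A|)%card.
Proof.
move=> f_inj; have [A0|[t0 _]] := set_0Vmem A.
  rewrite A0 cards0 II0 (_ : [set t | _] = set0) ?image_set0 //.
  by apply/seteqP; split=> t //=; rewrite inE.
have -> : f @` [set t | t \in A] = (f \o nth t0 (enum A)) @` `I_#|A|.
  apply/seteqP; split=> y /= [].
    move=> t tA <-; exists (index t (enum A)); last by rewrite nth_index ?mem_enum.
    by rewrite /= cardE index_mem mem_enum.
  by move=> i iA <-; exists (nth t0 (enum A) i) => //=; rewrite -mem_enum mem_nth // -cardE.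
apply: inj_card_eq => i l; rewrite !inE /= => iA lA.
have inA h : (h < #|A|)%N -> nth t0 (enum A) h \in A.
  by move=> hA; rewrite -mem_enum mem_nth // -cardE.
move=> /(f_inj _ _ (inA _ iA) (inA _ lA))/eqP.
by rewrite nth_uniq ?enum_uniq -?cardE // => /eqP.
Qed.

Lemma card_half_open_faces (R : realType) n k j :
  (half_open_faces R n k j #= `I_#|face_types n k j|)%card.
Proof.
rewrite half_open_facesE; apply: card_image_set => s t.
rewrite !inE => /andP[s_adm _] /andP[t_adm _].
exact: half_open_cell_inj.
Qed.

(** * Counting the types *)

Lemma sum_disjoint_pairs (T : finType) (m s : nat) :
  (\sum_(p : {set T} * {set T})
     [&& p.2 \subset ~: p.1, #|p.1| == m & #|p.2| == s] = 'C(#|T|, m) * 'C(#|T| - m, s))%N.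
Proof.
transitivity (\sum_(M : {set T}) \sum_(B : {set T})
    [&& B \subset ~: M, #|M| == m & #|B| == s] : nat)%N.
  by rewrite pair_bigA.
rewrite -[in RHS]card_draws -sum_nat_const [RHS]big_mkcond /=.
apply: eq_bigr => M _; rewrite inE.
have [<-|_] := eqVneq #|M| m; last by rewrite big1 // => B _; rewrite andbF.
rewrite -(cardsC M) addKn -cards_draws -sum1_card [RHS]big_mkcond /=.
by apply: eq_bigr => B _; rewrite inE; case: andP.
Qed.

(** Only M empty, b true and |B| = k survive: |M| = 1 with b true would need an integer strictly
    between |B| and |B| + 1. *)
Lemma card_face_types0 n k : (0 < k)%N -> #|face_types n k 0| = 'C(n, k).
Proof.
move=> k0; rewrite -[n in RHS]card_ord -card_draws.
pose h (B : {set 'I_n}) : face_type n := (finset.set0, B, true).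
have h_inj : injective h by move=> B C [].
rewrite -(card_imset _ h_inj); apply: eq_card => -[[M B] b].
apply/idP/imsetP => [|[C]].
  rewrite inE /admissible /= => /andP[/andP[_ adm] d].
  have [bT M0 BK] : [/\ b = true, #|M| = 0%N & #|B| = k].
    by move: adm d; case: b => /= [/orP[/andP[/eqP ? /eqP ?]|/andP[? ?]]|/andP[? ?]] /eqP ?;
      split=> //; lia.
  by exists B; rewrite ?inE ?BK // /h bT (cards0_eq M0).
rewrite inE => /eqP Ck [-> -> ->].
by rewrite inE /admissible /= cards0 Ck !eqxx /= andbT finset.setC0 finset.subsetT.
Qed.

(** For j > 0, dimension j means |M| = j + b, and for either value of b admissibility then reads k -
    j <= |B| < k with B disjoint from M. *)
Lemma card_face_types n k j : (0 < j)%N ->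
  #|face_types n k j| = (\sum_(k - j <= s < k)
     ('C(n, j) * 'C(n - j, s) + 'C(n, j.+1) * 'C(n - j.+1, s)))%N.
Proof.
move=> j0.
pose w (b : bool) s (p : {set 'I_n} * {set 'I_n}) : nat :=
  [&& p.2 \subset ~: p.1, #|p.1| == j + b & #|p.2| == s]%N.
(* At most one [s], namely |B|, contributes to the sum of indicators [w], so that sum is the
   indicator of membership. *)
have memE p b : ((p, b) \in face_types n k j) =
    (\sum_(k - j <= s < k) w b s p)%N :> nat.
  have wE s : w b s p = if s == #|p.2| then
      ((p.2 \subset ~: p.1) && (#|p.1| == j + b)%N : nat) else 0%N.
    by rewrite /w (eq_sym s); case: (eqVneq #|p.2| s); rewrite ?andbT // !andbF.
  rewrite (eq_bigr _ (fun s _ => wE s)) -big_mkcond big_nat1_eq.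
  rewrite inE; case: p {wE} => M B /=; case: (B \subset ~: M) => /=; last by case: ifP.
  by case: b; case: ifP; lia.
rewrite -sum1_card big_mkcond /=.
rewrite (eq_bigr (fun t : face_type n => \sum_(k - j <= s < k) w t.2 s t.1)%N); last first.
  by case=> p b _; rewrite -memE; case: ifP.
rewrite exchange_big; apply: eq_bigr => s _ /=.
rewrite -(pair_bigA _ (fun p b => w b s p)) /= exchange_big /= big_bool /=.
rewrite addnC; congr (_ + _)%N.
  by rewrite -[n in RHS]card_ord -sum_disjoint_pairs; apply: eq_bigr => p _; rewrite /w addn0.
by rewrite -[n in RHS]card_ord -sum_disjoint_pairs; apply: eq_bigr => p _; rewrite /w addn1.
Qed.

(** The factor n + 1 keeps the identity in the naturals. Extracting C(n+1,j+1) leaves (j + 1)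
    C(n-j,s) + (n - j) C(n-j-1,s); the last product is (n - j - s) C(n-j,s), and the coefficients
    add up to n - s + 1. *)
Lemma binomial_identity n j s : (j <= n)%N ->
  (n.+1 * ('C(n, j) * 'C(n - j, s) + 'C(n, j.+1) * 'C(n - j.+1, s)) =
   'C(n.+1, j.+1) * ('C(n - j, s) * (n - s + 1)))%N.
Proof.
move=> jn; rewrite mulnDr !mulnA (mul_bin_diag n.+1 j) (mul_bin_down n.+1 j.+1) /=.
have down : ((n - j) * 'C(n - j.+1, s) = (n - j - s) * 'C(n - j, s))%N.
  by rewrite subnS mul_bin_down.
rewrite subSS [((n - j) * _ * _)%N]mulnAC down.
have [sle|slt] := leqP s (n - j); last by rewrite (bin_small slt) !(mul0n, muln0).
have -> : (n - s + 1 = j.+1 + (n - j - s))%N by lia.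
by ring.
Qed.

Theorem theorem1p2 (R : realType) (n k : nat) (hk0 : (0 < k)%N) (hkn : (k <= n)%N) :
  (half_open_faces R n k 0 #= `I_('C(n, k)))%card /\
  (forall j : nat, (1 <= j <= n)%N ->
     exists N : nat, (half_open_faces R n k j #= `I_N)%card /\
       (N%:R : R) = ('C(n.+1, j.+1))%:R *
         \sum_(maxn 0 (k - j) <= s < k)
            ('C(n - j, s))%:R * ((n - s + 1)%:R / (n + 1)%:R)).
Proof.
split; first by rewrite -(card_face_types0 n k hk0); exact: card_half_open_faces.
move=> j /andP[j0 jn]; exists #|face_types n k j|; split.
  exact: card_half_open_faces.
rewrite card_face_types // max0n mulr_sumr natr_sum; apply: eq_bigr => s _.
have n0 : (n.+1%:R : R) != 0 by rewrite pnatr_eq0.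
apply: (mulfI n0); rewrite -natrM binomial_identity // !natrM addn1.
by field; rewrite natr1.
Qed.
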